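(* Let $s,t \geq 2$ be integers. Let $H$ be an $(s,t-1)$-linear hypergraph with $m$ vertices and $n$ edges such that $H$ has exactly $n_i$ edges of size $i$ for each $i \in \{s-1,\ldots,m\}$, and no edges of size less than $s-1$. For any positive integers $v$ and $k$ such that $v < s \leq k \leq m$, we have \[ \frac{1}{ \binom{k-v}{s-v} - \alpha } \sum_{i=s-1}^{k-1} \left( \binom{i-v}{s-v} - \alpha \right) \binom{i}{v} n_i + \sum_{i=k}^m \binom{i}{v} n_i \leq \binom{m}{v} \frac{(t-1) \binom{m-v}{s-v} - \alpha}{\binom{k-v}{s-v}}, \] where $\alpha$ is the integer such that $\alpha \equiv (t-1)\binom{m-v}{s-v} \pmod{\binom{k-v}{s-v}}$ and $0 \leq \alpha < \binom{k-v}{s-v}$.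
   Context: A hypergraph $H$ consists of a finite set of vertices $V(H)$ and a multiset $E(H)$ of edges, where each edge is a nonempty subset of $V(H)$ (so repeated edges are allowed, and edges are counted with multiplicity). A hypergraph is called $(s,t-1)$-linear if each set of $s$ vertices is a subset of at most $t-1$ edges (counted with multiplicity). *)

(* Defs.v *)
From HB Require Import structures.
From mathcomp Require Import all_boot all_order all_algebra.
From mathcomp Require Import finmap multiset.

Set Implicit Arguments.
Unset Strict Implicit.
Unset Printing Implicit Defensive.

Record hypergraph := Hypergraph {
  vertex : finType;
  edges : {mset {set vertex}}%mset;
  edges_nonempty : forall e : {set vertex}, e \in edges -> e != set0
}.

Definition num_vertices (H : hypergraph) : nat := #|vertex H|.

(* A multiset coerces to the sequence listing each element as many times as
   its multiplicity, so [size] and [count] below count with multiplicity.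
   ([#|edges H|] would not.) *)
Definition num_edges (H : hypergraph) : nat := size (edges H).

Definition num_edges_of_size (H : hypergraph) (i : nat) : nat :=
  count (fun e : {set vertex H} => #|e| == i) (edges H).

Definition linear_hypergraph (s l : nat) (H : hypergraph) : Prop :=
  forall S : {set vertex H}, #|S| = s ->
    count (fun e : {set vertex H} => S \subset e) (edges H) <= l.

(* Main.v *)
Require Import Defs.
From HB Require Import structures.
From mathcomp Require Import all_boot all_order all_algebra.
From mathcomp Require Import finmap multiset.
From mathcomp Require Import zify lra.
Import Order.TTheory GRing.Theory Num.Theory.

(** Fix a set [T] of [v] vertices.  Counting the [s]-sets [S] with
    [T] contained in [S] contained in an edge [e] gives
    [\sum_(e | T \subset e) 'C(#|e| - v, s - v) <= (t - 1) 'C(m - v, s - v) = q D + alpha],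
    where [D = 'C(k - v, s - v)].  Truncating the summands at [D] and
    subtracting [alpha] from each, the sum is at most [q (D - alpha)]: either
    there are at most [q] summands, each at most [D - alpha], or there are at
    least [q + 1] of them and [alpha] has been subtracted that many times.
    Summing over all [T] counts an edge of size [i] exactly ['C(i, v)] times. *)

Local Open Scope ring_scope.

(** Adding [A] is a bijection from the subsets of [B :\: A] of size [s - #|A|] onto the sets counted
    here; removing [A] is its inverse. *)
Lemma card_between {U : finType} {A B : {set U}} {s : nat} :
    A \subset B -> (#|A| <= s)%N ->
  #|[set S : {set U} | [&& A \subset S, S \subset B & #|S| == s]]|
    = 'C(#|B| - #|A|, s - #|A|).
Proof.
move=> sAB leAs; rewrite -(cardsDS sAB) -cards_draws.
have injU : {in [set X : {set U} | X \subset B :\: A & #|X| == (s - #|A|)%N] &,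
    injective (fun X => A :|: X)}.
  move=> X Y; rewrite !inE => /andP[sX _] /andP[sY _] eqXY.
  have K (Z : {set U}) : Z \subset B :\: A -> (A :|: Z) :\: A = Z.
    rewrite subsetD => /andP[_]; rewrite disjoint_sym => dAZ.
    by rewrite setDUl setDv set0U; apply/setDidPl; rewrite disjoint_sym.
  by rewrite -(K X sX) -(K Y sY) eqXY.
rewrite -(card_in_imset injU); apply: eq_card => S; rewrite inE.
apply/idP/imsetP => [/and3P[sAS sSB /eqP cS]|[X]].
  exists (S :\: A); last by rewrite -{1}(setID S A) (setIidPr sAS).
  by rewrite inE setSD //= cardsDS // cS.
rewrite inE subsetD => /andP[/andP[sXB dXA] /eqP cX] ->.
rewrite subsetUl subUset sAB sXB /= cardsU.
by rewrite (_ : A :&: X = set0) ?cards0 ?cX; [lia | apply/disjoint_setI0; rewrite disjoint_sym].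
Qed.

(** Double count the pairs [(S, e)] with [T \subset S \subset e] and [#|S| = s]: linearity allows
    each [S] at most [l] edges. *)
Lemma linear_link_bound {H : hypergraph} {s l : nat} {T : {set vertex H}} :
    linear_hypergraph s l H -> (#|T| <= s)%N ->
  (\sum_(e <- edges H | T \subset e) 'C(#|e| - #|T|, s - #|T|)
    <= l * 'C(num_vertices H - #|T|, s - #|T|))%N.
Proof.
move=> hlin leTs.
(* The trivially true condition [S \subset [set: _]] lets [card_between] count the index set as
   well, with the whole vertex set as [B]. *)
rewrite (eq_bigr (fun e : {set vertex H} =>
    \sum_(S : {set vertex H} | [&& T \subset S, S \subset [set: _] & #|S| == s])
      (S \subset e : nat))%N); last first.
  move=> e sTe; rewrite -(card_between sTe leTs) -sum1_card big_mkcond.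
  rewrite [in RHS]big_mkcond; apply: eq_bigr => S _.
  by rewrite inE subsetT; case: (T \subset S) (S \subset e) (#|S| == s) => [] [] [].
rewrite exchange_big /= /num_vertices -cardsT.
rewrite -(card_between (subsetT T) leTs) mulnC -sum_nat_const.
rewrite [leqRHS](eq_bigl _ _ (fun S => in_set _ S)).
apply: leq_sum => S /and3P[_ _ /eqP cS]; apply: leq_trans (hlin S cS).
rewrite -sum1_count big_mkcond [leqRHS]big_mkcond /=.
by apply: leq_sum => e _; case: ifP => // _; case: (S \subset e).
Qed.

Lemma sum_truncate_sub_le {R : realDomainType} {I : Type} {r : seq I}
    {P : pred I} {c : I -> nat} {D a q : nat} :
    (a <= D)%N -> (\sum_(i <- r | P i) c i <= q * D + a)%N ->
  \sum_(i <- r | P i) ((minn (c i) D)%:R - a%:R) <= q%:R * (D%:R - a%:R) :> R.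
Proof.
move=> leaD lesum; have [leq_q|lt_q] := leqP (count P r) q.
  apply: (@le_trans _ _ (\sum_(i <- r | P i) (D%:R - a%:R))).
    by apply: ler_sum => i _; rewrite lerD2r ler_nat geq_minr.
  rewrite big_const_seq iter_addr_0 -[leLHS]mulr_natl.
  by apply: ler_wpM2r; rewrite ?subr_ge0 ler_nat.
have lesumD : \sum_(i <- r | P i) (minn (c i) D)%:R <= q%:R * D%:R + a%:R :> R.
  rewrite -natr_sum -natrM -natrD ler_nat (leq_trans _ lesum) //.
  by apply: leq_sum => i _; apply: geq_minl.
rewrite sumrB big_const_seq iter_addr_0 -[_ *+ count P r]mulr_natl lerBlDr.
(* With at least [q + 1] summands, at least [(q + 1) a] is subtracted from a total of at most
   [q D + a], which leaves [q (D - a)]. *)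
have : q.+1%:R * a%:R <= (count P r)%:R * a%:R :> R.
  by apply: ler_wpM2r; rewrite ?ler_nat.
by rewrite -natr1; lra.
Qed.

Lemma sum_edges_by_size (H : hypergraph) {R : nzSemiRingType} (f : nat -> R) :
  \sum_(e <- edges H) f #|e|
    = \sum_(0 <= i < (num_vertices H).+1) f i * (num_edges_of_size H i)%:R.
Proof.
rewrite /num_edges_of_size.
under [RHS]eq_bigr => i _.
  rewrite -sum1_count natr_sum big_distrr /= big_mkcond /=. over.
rewrite exchange_big /=; apply: eq_bigr => e _.
(* Each edge contributes only at the index equal to its own size. *)
rewrite big_mkord (bigD1 (inord #|e|)) //=.
have le_e : (#|e| < (num_vertices H).+1)%N by rewrite ltnS max_card.
rewrite inordK // eqxx mulr1 big1 ?addr0 // => i.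
by case: ifP => // /eqP ->; rewrite inord_val eqxx.
Qed.

Theorem theorem1p2
  (s t : nat) (hs : (2 <= s)%N) (ht : (2 <= t)%N)
  (H : hypergraph) (m n : nat) (n_ : nat -> nat)
  (hlin : linear_hypergraph s (t - 1)%N H)
  (hm : num_vertices H = m)
  (hn : num_edges H = n)
  (hn_ : forall i : nat, (s - 1 <= i <= m)%N -> num_edges_of_size H i = n_ i)
  (hsmall : forall i : nat, (i < s - 1)%N -> num_edges_of_size H i = 0%N)
  (v k : nat) (hv : (0 < v)%N) (hk : (0 < k)%N)
  (hvs : (v < s)%N) (hsk : (s <= k)%N) (hkm : (k <= m)%N)
  (alpha : int)
  (halpha : (alpha = ((t - 1) * 'C(m - v, s - v))%N%:Z
              %[mod 'C(k - v, s - v)%:Z])%Z)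
  (halpha0 : 0 <= alpha) (halphaD : alpha < 'C(k - v, s - v)%:Z) :
  1 / ('C(k - v, s - v)%:R - alpha%:~R)
    * (\sum_(s - 1 <= i < k)
         ('C(i - v, s - v)%:R - alpha%:~R) * 'C(i, v)%:R * (n_ i)%:R)
  + \sum_(k <= i < m.+1) 'C(i, v)%:R * (n_ i)%:R
  <= 'C(m, v)%:R
     * (((t - 1)%N%:R * 'C(m - v, s - v)%:R - alpha%:~R)
        / 'C(k - v, s - v)%:R) :> rat.
Proof.
case: alpha halpha halpha0 halphaD => [a|//] halpha _ ltaD.
rewrite -!pmulrn.
set D := 'C(k - v, s - v) in halpha ltaD *.
set N := ((t - 1) * 'C(m - v, s - v))%N in halpha.
have {}ltaD : (a < D)%N by [].
have aE : a = (N %% D)%N.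
  by have := halpha; rewrite !modz_nat (modn_small ltaD) => -[].
pose q := (N %/ D)%N.
have NE : N = (q * D + a)%N by rewrite aE -divn_eq.
have Da_gt0 : 0 < D%:R - a%:R :> rat by rewrite subr_gt0 ltr_nat.
have D_neq0 : D%:R != 0 :> rat by rewrite pnatr_eq0; lia.
(* Since binomials are monotone, truncation at [D] acts only from size [k] on. So [w] gives the
   coefficients of the first sum below [k] and the constant [D - a] from [k] on. *)
pose w i : rat := (minn 'C(i - v, s - v) D)%:R - a%:R.
have w_small i : (i < k)%N -> w i = 'C(i - v, s - v)%:R - a%:R.
  by move=> ltik; rewrite /w (minn_idPl _) // leq_bin2l //; lia.
have w_large i : (k <= i)%N -> w i = D%:R - a%:R.
  by move=> leki; rewrite /w (minn_idPr _) // leq_bin2l //; lia.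
have sum_sizes : \sum_(e <- edges H) w #|e| * 'C(#|e|, v)%:R
    = \sum_(s - 1 <= i < k)
        ('C(i - v, s - v)%:R - a%:R) * 'C(i, v)%:R * (n_ i)%:R
      + (D%:R - a%:R) * \sum_(k <= i < m.+1) 'C(i, v)%:R * (n_ i)%:R.
  rewrite (sum_edges_by_size H (fun i => w i * 'C(i, v)%:R)) hm.
  rewrite (@big_cat_nat _ _ _ (s - 1)) //=; last by lia.
  rewrite big_nat big1 ?add0r; last first.
    by move=> i /andP[_ lti]; rewrite hsmall ?mulr0.
  rewrite (@big_cat_nat _ _ _ k) //=; [|lia|lia].
  rewrite big_distrr /=; congr (_ + _); apply: eq_big_nat => i ranges_i.
    by rewrite hn_ ?w_small //; lia.
  by rewrite hn_ ?w_large ?mulrA //; lia.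
(* An edge [e] contains exactly ['C(#|e|, v)] of the sets [T]. *)
have sum_links : \sum_(e <- edges H) w #|e| * 'C(#|e|, v)%:R
    = \sum_(T : {set vertex H} | #|T| == v)
        \sum_(e <- edges H | T \subset e) w #|e|.
  rewrite (exchange_big_dep xpredT) //=; apply: eq_bigr => e _.
  rewrite sumr_const mulr_natr -cards_draws; congr (_ *+ _).
  by apply: eq_card => T; rewrite !inE /in_mem /= andbC.
have key : \sum_(e <- edges H) w #|e| * 'C(#|e|, v)%:R
    <= 'C(m, v)%:R * (q%:R * (D%:R - a%:R)).
  rewrite sum_links -hm /num_vertices -card_draws mulr_natl -sumr_const.
  rewrite [leRHS](eq_bigl _ _ (fun T => in_set _ T)).
  apply: ler_sum => T /eqP cT.
  apply: sum_truncate_sub_le; first exact: ltnW.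
  rewrite -NE /N -hm -cT; apply: linear_link_bound => //; lia.
(* The quotient [(N - a) / D] is exactly [q]; multiplying both sides by [D - a > 0] then reduces the
   goal to [key]. *)
rewrite -natrM -/N NE natrD natrM addrK mulfK // mul1r.
rewrite -(ler_pM2r Da_gt0) -mulrA; apply: le_trans key.
rewrite sum_sizes mulrDl mulrAC mulVf ?gt_eqF // mul1r.
by rewrite [X in _ + X]mulrC.
Qed.
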